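(* Let $1<p<\infty$. Then, for any $f\in L^p(0,\infty)$, $$ \int_0^\infty \sup_{0<s<\infty} \left| \min\left\{ \frac1r,\frac1s \right\} \int_0^s f(t)\,dt \right|^p dr \leq \left( \frac{p}{p-1}\right)^p \int_0^\infty |f(r)|^p\,dr \,. $$ *)

(* Defs.v *)
From HB Require Import structures.
From mathcomp Require Import all_boot all_order all_algebra.
From mathcomp Require Import all_classical all_reals all_analysis.

(* Main.v *)
Require Import Defs.
From HB Require Import structures.
From mathcomp Require Import all_boot all_order all_algebra.
From mathcomp Require Import all_classical all_reals all_analysis.
From mathcomp Require Import measurable_realfun ring lra.
Import Order.TTheory GRing.Theory Num.Theory.
Import numFieldNormedType.Exports.
Local Open Scope classical_set_scope.
Local Open Scope ring_scope.

(* Let F(s) be the integral of |f| over (0,s) and g(r) = sup_s min(1/r,1/s) F(s).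
   For l > 0 the set E = {g > l} is an interval starting at 0: if r lies in E with
   witness s, then l r < F(s) and l s < F(s), and the latter puts (0,s) inside E, so
   that l r < F(s) is at most the integral of |f| over E.  Hence l |E| is at most the
   integral of |f| over E, which is Doob's maximal inequality: by the layer cake
   formula and Tonelli, int g^p <= q int |f| g^(p-1) with q = p/(p-1), and
   Young's inequality absorbs the right-hand side into int g^p, with constant q^p.
   Finiteness of int g^p is obtained by truncating and letting the truncation go to
   infinity. *)

(** Fundamental theorem of calculus. Since [1 < q], the integrand stays continuous up to the
    endpoint 0, where differentiability rules for [powR] do not apply and the limit is taken
    separately. *)
Lemma integral_powR_deriv (R : realType) (q h : R) : 1 < q -> 0 <= h ->
  (\int[@lebesgue_measure R]_(m in `]0%R, h[) (q * m `^ (q - 1))%:E = (h `^ q)%:E)%E.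
Proof.
move=> q1; rewrite le_eqVlt => /predU1P[<-|h0].
  by rewrite set_itvoo0 integral_set0 powR0// gt_eqF// (lt_trans ltr01).
have q0 : 0 < q by exact: lt_trans q1.
have q10 : 0 < q - 1 by rewrite subr_gt0.
have cpow1 r x : 0 < x -> {for x, continuous (@powR R ^~ r)}.
  move=> x0; apply: differentiable_continuous; apply/derivable1_diffP.
  by apply: derivable_powR; rewrite in_itv/= x0.
have cpow r : 0 < r -> {within `[0%R, h], continuous (@powR R ^~ r)}.
  move=> r0; apply/continuous_within_itvP => //; split.
  - by move=> x; rewrite in_itv/= => /andP[x0 _]; exact: cpow1.
  - by rewrite powR0 ?gt_eqF//; exact: powR_cvg0.
  - by apply: cvg_at_left_filter; exact: cpow1.
rewrite -(@integral_itv_bndoo _ _ _ _ true false); last first.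
  by apply/measurable_EFinP; apply: measurable_funTS; apply: measurable_funM => //;
    exact: measurable_powR.
rewrite (@continuous_FTC2 _ _ (@powR R ^~ q))//.
- by rewrite powR0 ?gt_eqF// sube0.
- by move=> x; apply: cvgM; [exact: cvg_cst|exact: cpow].
- have /continuous_within_itvP := cpow q q0 => /(_ h0)[_ c0 ch]; split => //.
  by move=> x /[!in_itv]/= /andP[x0 _]; apply: derivable_powR; rewrite in_itv/= x0.
- by move=> x /[!in_itv]/= /andP[x0 _]; rewrite powR_derive1// in_itv/= x0.
Qed.

(** * From the weak-type bound to the strong-type bound *)

Section maximal_inequality.
Local Open Scope ereal_scope.

(** Write [g^p = h^q] with [h = g^(p-1)], expand [h^q] as the integral of [q m^(q-1)] over
    [0 < m < h], and exchange integrals. The weak bound at level [m^(q-1)] then applies for each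
    [m], and integrating back in [m] yields [q f h]. *)
Lemma weak_type_layer_cake d (T : measurableType d) (R : realType)
    (mu : {sigma_finite_measure set T -> \bar R}) (f g : T -> R) (p : R) :
  (1 < p)%R -> measurable_fun setT f -> measurable_fun setT g ->
  (forall x, 0 <= f x)%R -> (forall x, 0 <= g x)%R ->
  (forall l : R, (0 < l)%R ->
    l%:E * mu [set x | l < g x]%R <= \int[mu]_(x in [set x | l < g x]%R) (f x)%:E) ->
  \int[mu]_x (g x `^ p)%:E <=
    (p / (p - 1))%:E * \int[mu]_x (f x * g x `^ (p - 1))%:E.
Proof.
move=> p1 mf mg f0 g0 weak; set q := (p / (p - 1))%R.
have p0 : (0 < p)%R by exact: lt_trans p1.
have p10 : (0 < p - 1)%R by rewrite subr_gt0.
have q1 : (1 < q)%R by rewrite /q ltr_pdivlMr// mul1r gtrBl.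
have q0 : (0 < q)%R by exact: lt_trans q1.
have q10 : (0 < q - 1)%R by rewrite subr_gt0.
have pq : ((p - 1) * q = p)%R by rewrite /q mulrC divfK// gt_eqF.
have pq1 : ((p - 1) * (q - 1) = 1)%R by rewrite mulrBr pq mulr1; ring.
(* Slicing h rather than g makes the weight m^(q-1) continuous at 0; the weight
   l^(p-2) of the usual layer cake for g^p would be singular there when p < 2. *)
pose h x := (g x `^ (p - 1))%R.
have h0 x : (0 <= h x)%R by exact: powR_ge0.
have mh : measurable_fun setT h.
  exact: (measurableT_comp (measurable_powR (p - 1)) mg).
have hE x : (h x `^ q = g x `^ p)%R by rewrite -powRrM pq.
(* As [(p-1)(q-1) = 1], the powers [p-1] and [q-1] are inverse to each other on nonnegative
   reals. *)
have lth (m : R) x : (0 < m)%R -> (m < h x)%R = (m `^ (q - 1) < g x)%R.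
  move=> m0; have e1 : (m = (m `^ (q - 1)) `^ (p - 1))%R.
    by rewrite -powRrM mulrC pq1 powRr1// ltW.
  have e2 : (g x = h x `^ (q - 1))%R by rewrite -powRrM pq1 powRr1.
  apply/idP/idP => H.
    by rewrite e2; apply: gt0_ltr_powR => //; rewrite ?nnegrE// ltW.
  by rewrite e1; apply: gt0_ltr_powR => //; rewrite ?nnegrE ?powR_ge0// ltW.
pose GR := measurableTypeR R.
(* The region under the graph of [h]; its indicator puts both sides over the same product space for
   Tonelli. *)
pose A : set (T * GR) := [set z | 0 < z.2 < h z.1]%R.
have mA : measurable A.
  pose B (z : T * GR) := ((0 < z.2) && (z.2 < h z.1))%R.
  have mB : measurable_fun setT B.
    apply: measurable_and; apply: measurable_fun_ltr => //.
    exact: measurableT_comp.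
  rewrite (_ : A = B @^-1` [set true]); last by apply/seteqP; split.
  by rewrite -[X in measurable X]setTI; exact: mB.
have m1A : measurable_fun setT (\1_A : T * GR -> R) by exact: measurable_indic.
have sliceT (c : R -> \bar R) x : (forall m, 0 <= c m) ->
    \int[@lebesgue_measure R]_m (c m * (\1_A (x, m))%:E) =
    \int[@lebesgue_measure R]_(m in `]0%R, h x[) c m.
  move=> c0; rewrite [RHS]integral_mkcond; apply: eq_integral => m _.
  rewrite patchE indicE; case: (boolP (m \in _)) => hm.
    by rewrite mem_set ?mule1//; move: hm; rewrite inE/= in_itv.
  by rewrite memNset ?mule0//; move: hm; rewrite notin_setE/= in_itv.
have sliceR (c : T -> \bar R) (m : R) : (0 < m)%R ->
    \int[mu]_x (c x * (\1_A (x, m))%:E) =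
    \int[mu]_(x in [set x | m `^ (q - 1) < g x]%R) c x.
  move=> m0; rewrite [RHS]integral_mkcond; apply: eq_integral => x _.
  rewrite patchE indicE; case: (boolP (x \in _)) => hx.
    by rewrite mem_set ?mule1//; move: hx; rewrite inE/= /A/= m0 lth.
  by rewrite memNset ?mule0//; move: hx; rewrite notin_setE/= /A/= m0 lth.
have -> : \int[mu]_x (g x `^ p)%:E =
    \int[mu]_x \int[@lebesgue_measure R]_m ((q * m `^ (q - 1))%:E * (\1_A (x, m))%:E).
  apply: eq_integral => x _; rewrite sliceT ?integral_powR_deriv ?hE// => m.
  by rewrite lee_fin mulr_ge0 ?powR_ge0// ltW.
have -> : \int[mu]_x (f x * g x `^ (p - 1))%:E =
    \int[mu]_x \int[@lebesgue_measure R]_m ((f x)%:E * (\1_A (x, m))%:E).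
  apply: eq_integral => x _.
  rewrite (sliceT (fun=> (f x)%:E)) ?integral_cst// => [|m]; last by rewrite lee_fin.
  rewrite EFinM; congr (_ * _).
  transitivity (@lebesgue_measure R `]0%R, h x[); last by [].
  rewrite lebesgue_measure_itv/= lte_fin sube0 -/(h x).
  by have := h0 x; rewrite le_eqVlt => /predU1P[<-|->]; rewrite ?ltxx.
have mk1 : measurable_fun setT
    (fun z : T * GR => (q * z.2 `^ (q - 1))%:E * (\1_A z)%:E).
  apply: emeasurable_funM; apply/measurable_EFinP => //.
  apply: measurable_funM => //.
  exact: (measurableT_comp (measurable_powR (q - 1)) measurable_snd).
have mk2 : measurable_fun setT (fun z : T * GR => (f z.1)%:E * (\1_A z)%:E).
  apply: emeasurable_funM; apply/measurable_EFinP => //.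
  exact: measurableT_comp.
have k1_ge0 z : 0 <= (q * z.2 `^ (q - 1))%:E * (\1_A z)%:E.
  rewrite -EFinM lee_fin; apply: mulr_ge0 => //.
  by apply: mulr_ge0; [exact: ltW|exact: powR_ge0].
have k2_ge0 z : 0 <= (f z.1)%:E * (\1_A z)%:E.
  by rewrite -EFinM lee_fin mulr_ge0.
rewrite (fubini_tonelli (m1 := mu) (m2 := @lebesgue_measure R)
  (fun z : T * GR => (q * z.2 `^ (q - 1))%:E * (\1_A z)%:E)) //=.
rewrite (fubini_tonelli (m1 := mu) (m2 := @lebesgue_measure R)
  (fun z : T * GR => (f z.1)%:E * (\1_A z)%:E)) //=.
rewrite -ge0_integralZl//=; [|..]; last 3 first.
- exact: (measurable_fun_fubini_tonelli_G (fun z : T * GR => (f z.1)%:E * (\1_A z)%:E)).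
- by move=> m _; apply: integral_ge0 => x _; exact: (k2_ge0 (x, m)).
- by rewrite lee_fin ltW.
apply: ge0_le_integral => //=.
- by move=> m _; apply: integral_ge0 => x _; exact: (k1_ge0 (x, m)).
- exact: (measurable_fun_fubini_tonelli_G
    (fun z : T * GR => (q * z.2 `^ (q - 1))%:E * (\1_A z)%:E)).
- apply: emeasurable_funM => //.
  exact: (measurable_fun_fubini_tonelli_G (fun z : T * GR => (f z.1)%:E * (\1_A z)%:E)).
move=> m _; have [m0|m0] := leP m 0%R.
  rewrite integral0_eq; last first.
    move=> x _; rewrite indicE memNset ?mule0//= /A/= => /andP[].
    by rewrite ltNge m0.
  rewrite mule_ge0 ?lee_fin ?(ltW q0)//.
  by apply: integral_ge0 => x _; exact: (k2_ge0 (x, m)).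
(* After the slices are computed, the weight [m^(q-1)] is exactly the level of the slice, so
   cancelling [q] leaves the weak-type hypothesis. *)
rewrite (sliceR (fun=> (q * m `^ (q - 1))%:E))// (sliceR (EFin \o f))//.
rewrite integral_cst//; last first.
  rewrite -preimage_itvoy -[X in measurable X]setTI.
  exact: mg.
rewrite EFinM -muleA lee_pmul2l ?lte_fin//.
by apply: weak; exact: powR_gt0.
Qed.

(** Young's inequality splits the layer-cake bound into [q^p/p] times the integral of [f^p] plus
    [1/q] times that of [g^p]. The finiteness hypothesis allows the latter to be subtracted. *)
Lemma weak_type_strong_type d (T : measurableType d) (R : realType)
    (mu : {sigma_finite_measure set T -> \bar R}) (f g : T -> R) (p : R) :
  (1 < p)%R -> measurable_fun setT f -> measurable_fun setT g ->
  (forall x, 0 <= f x)%R -> (forall x, 0 <= g x)%R ->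
  (forall l : R, (0 < l)%R ->
    l%:E * mu [set x | l < g x]%R <= \int[mu]_(x in [set x | l < g x]%R) (f x)%:E) ->
  \int[mu]_x (g x `^ p)%:E < +oo ->
  \int[mu]_x (g x `^ p)%:E <=
    ((p / (p - 1)) `^ p)%:E * \int[mu]_x (f x `^ p)%:E.
Proof.
move=> p1 mf mg f0 g0 weak gfin.
have p0 : (0 < p)%R by exact: lt_trans p1.
have p10 : (0 < p - 1)%R by rewrite subr_gt0.
pose q := (p / (p - 1))%R.
have q1 : (1 < q)%R by rewrite /q ltr_pdivlMr// mul1r gtrBl.
have q0 : (0 < q)%R by exact: lt_trans q1.
have pq : ((p - 1) * q = p)%R by rewrite /q mulrC divfK// gt_eqF.
have pVq : (p^-1 + q^-1 = 1)%R.
  by rewrite /q; field; rewrite !gt_eqF.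
have mpow (h : T -> R) r : measurable_fun setT h ->
    measurable_fun setT (fun x => (h x `^ r)%:E).
  by move=> mh; apply/measurable_EFinP; exact: (measurableT_comp (measurable_powR r) mh).
have pow0 (h : T -> R) r x : 0 <= (h x `^ r)%:E by rewrite lee_fin powR_ge0.
have young : q%:E * \int[mu]_x (f x * g x `^ (p - 1))%:E <=
    (q `^ p / p)%:E * \int[mu]_x (f x `^ p)%:E + (q^-1)%:E * \int[mu]_x (g x `^ p)%:E.
  have c0 : (0 <= q `^ p / p)%R by rewrite divr_ge0 ?powR_ge0// ltW.
  have qV0 : (0 <= q^-1)%R by rewrite invr_ge0 ltW.
  rewrite -!ge0_integralZl ?lee_fin ?(ltW q0)//; [|exact: mpow..| |]; last 2 first.
  - apply/measurable_EFinP; apply: measurable_funM => //.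
    by apply/measurable_EFinP; exact: mpow.
  - by move=> x _; rewrite lee_fin mulr_ge0 ?powR_ge0.
  rewrite -ge0_integralD//; last 4 first.
  - by move=> x _; rewrite mule_ge0 ?lee_fin ?powR_ge0.
  - by apply: measurable_funeM; exact: mpow.
  - by move=> x _; rewrite mule_ge0 ?lee_fin ?powR_ge0.
  - by apply: measurable_funeM; exact: mpow.
  apply: ge0_le_integral => //.
  - by move=> x _; rewrite mule_ge0 ?lee_fin ?(ltW q0)// mulr_ge0 ?powR_ge0.
  - apply: measurable_funeM; apply/measurable_EFinP; apply: measurable_funM => //.
    by apply/measurable_EFinP; exact: mpow.
  - by apply: emeasurable_funD; apply: measurable_funeM; exact: mpow.
  move=> x _; rewrite -!EFinM -EFinD lee_fin.
  (* Young is applied to [q f] and [g^(p-1)], with conjugate exponents [p] and [q]; the factor [q]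
     goes with [f], so that [g^p] receives only [1/q < 1]. *)
  rewrite mulrA (le_trans (conjugate_powR _ _ p0 q0 pVq))//.
  - by rewrite mulr_ge0// ltW.
  - exact: powR_ge0.
  - rewrite -powRrM pq powRM ?(ltW q0)//.
    by rewrite mulrAC (mulrC (g x `^ p)%R).
have := le_trans (weak_type_layer_cake _ _ _ _ _ _ _ p1 mf mg f0 g0 weak) young.
have : 0 <= \int[mu]_x (g x `^ p)%:E by exact: integral_ge0.
have : 0 <= \int[mu]_x (f x `^ p)%:E by exact: integral_ge0.
rewrite -/q; move: gfin.
case: (\int[mu]_x (g x `^ p)%:E) => // X _.
case: (\int[mu]_x (f x `^ p)%:E) => // [Y|]; last first.
  by move=> _ _ _; rewrite gt0_muley ?leey// lte_fin powR_gt0.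
rewrite -!EFinM -EFinD !lee_fin => Y0 X0.
(* Absorbing [X/q] leaves [X/p] on the left, and the factor [1/p] cancels from both sides. *)
have -> : (q^-1 = 1 - p^-1)%R by rewrite -pVq addrC addKr.
move=> H.
have : (X / p <= q `^ p * Y / p)%R by lra.
by rewrite ler_pM2r// invr_gt0.
Qed.

(* No measurability is assumed: the integrand of the theorem is a supremum over an
   uncountable family. *)
Lemma ge0_le_integral_nonmeasurable d (T : measurableType d) (R : realType)
    (mu : {measure set T -> \bar R}) (D : set T) (f g : T -> \bar R) :
  (forall x, D x -> 0 <= f x) -> (forall x, D x -> f x <= g x) ->
  \int[mu]_(x in D) f x <= \int[mu]_(x in D) g x.
Proof.
move=> f0 fg; rewrite !(integral_mkcond D).
have h1 x : 0 <= (f \_ D) x by exact: erestrict_ge0.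
have h12 x : (f \_ D) x <= (g \_ D) x by exact: lee_restrict.
rewrite !ge0_integralTE//; last by move=> x; exact: le_trans (h12 x).
apply: le_ereal_sup => _ [h hf <-]; exists h => // x.
exact: le_trans (h12 x).
Qed.

End maximal_inequality.

(** * The truncated maximal function *)

Section truncated.
Local Open Scope ereal_scope.
Variables (R : realType) (f : R -> R) (p : R).
Hypotheses (p1 : (1 < p)%R) (mf : measurable_fun setT f) (f0 : forall x, (0 <= f x)%R).
Hypothesis fp : \int[@lebesgue_measure R]_x (f x `^ p)%:E < +oo.
Local Notation mu := (@lebesgue_measure R).

Definition primitive (s : R) : R := fine (\int[mu]_(t in `]0%R, s[) (f t)%:E).

(** Pointwise [f <= 1 + f^p], which is integrable on the bounded interval, so [fine] loses
    nothing. *)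
Lemma primitiveE s : (primitive s)%:E = \int[mu]_(t in `]0%R, s[) (f t)%:E.
Proof.
rewrite fineK// ge0_fin_numE; last by apply: integral_ge0 => x _; rewrite lee_fin.
have p0 : (0 < p)%R by exact: lt_trans p1.
apply: (@le_lt_trans _ _ (\int[mu]_(t in `]0%R, s[) (1 + (f t `^ p)%:E))).
  apply: ge0_le_integral_nonmeasurable => x _; first by rewrite lee_fin.
  rewrite -EFinD lee_fin; have [fx1|fx1] := leP (f x) 1%R.
    by rewrite (le_trans fx1)// lerDl powR_ge0.
  by rewrite (@le_trans _ _ (f x `^ p)%R) ?lerDr// le1r_powR// ltW.
have mfp : measurable_fun setT (fun x => (f x `^ p)%:E).
  by apply/measurable_EFinP; exact: (measurableT_comp (measurable_powR p) mf).
rewrite ge0_integralD//; last 2 first.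
  by move=> x _; rewrite lee_fin powR_ge0.
  exact: measurable_funTS.
rewrite integral_cst// mul1e lte_add_pinfty//.
  by rewrite [X in X < _]lebesgue_measure_itv/=; case: ifP => _; rewrite ?sube0 ltry.
apply: le_lt_trans fp; apply: ge0_subset_integral => //.
by move=> x _; rewrite lee_fin powR_ge0.
Qed.

Lemma primitive_ge0 s : (0 <= primitive s)%R.
Proof. by rewrite fine_ge0// integral_ge0// => x _; rewrite lee_fin. Qed.

(** The cap at [N] bounds the family in [s], so that the real-valued [sup] taken over it is a
    genuine supremum and not a default value. *)
Definition kernel_avg (N r s : R) : R :=
  Num.min (Num.min r^-1 s^-1 * primitive s)%R N.

(* The truncation makes the L^p norm finite a priori, so that it can be absorbed. *)
Definition trunc_sup (N r : R) : R :=
  if (0 < r < N)%R then sup [set kernel_avg N r s | s in `]0%R, N]] else 0%R.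

Lemma trunc_sup_has_sup N r : (0 < r < N)%R ->
  has_sup [set kernel_avg N r s | s in `]0%R, N]].
Proof.
move=> /andP[r0 rN]; split.
  exists (kernel_avg N r N); exists N => //=.
  by rewrite in_itv/= lexx andbT (lt_trans r0).
by exists N => _ [s _ <-]; rewrite ge_min lexx orbT.
Qed.

Lemma kernel_avg_le N r s : (0 < r < N)%R -> (0 < s <= N)%R ->
  (kernel_avg N r s <= trunc_sup N r)%R.
Proof.
move=> rN sN; rewrite /trunc_sup rN; apply: ub_le_sup.
  exact: (trunc_sup_has_sup _ _ rN).2.
by exists s => //=; rewrite in_itv/= sN.
Qed.

Lemma kernel_avg_ge0 N r s : (0 < r)%R -> (0 < s)%R -> (0 <= N)%R ->
  (0 <= kernel_avg N r s)%R.
Proof.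
move=> r0 s0 N0; rewrite le_min N0 andbT mulr_ge0 ?primitive_ge0//.
by rewrite le_min !invr_ge0 !ltW.
Qed.

Lemma trunc_sup_ge0 N r : (0 <= trunc_sup N r)%R.
Proof.
have [rN|rN] := boolP (0 < r < N)%R; last by rewrite /trunc_sup (negbTE rN).
have /andP[r0 rN'] := rN; have N0 := lt_trans r0 rN'.
apply: le_trans (kernel_avg_le N r N rN _).
  by apply: kernel_avg_ge0 => //; exact: ltW.
by rewrite N0 lexx.
Qed.

Lemma trunc_sup_le N r : (0 <= N)%R -> (trunc_sup N r <= N)%R.
Proof.
move=> N0; rewrite /trunc_sup; case: ifPn => // rN.
apply: ge_sup; first exact: (trunc_sup_has_sup _ _ rN).1.
by move=> _ [s _ <-]; rewrite ge_min lexx orbT.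
Qed.

(** Clearing denominators splits the minimum of [1/r] and [1/s] into two inequalities; [r] enters
    only through [l * r] and the cut-off, which makes the shape of the level sets visible. *)
Lemma lt_trunc_supP N r l : (0 <= l)%R ->
  (l < trunc_sup N r)%R <-> [/\ (0 < r < N)%R, (l < N)%R &
    exists2 s, (0 < s <= N)%R & (l * r < primitive s)%R /\ (l * s < primitive s)%R].
Proof.
move=> l0.
have key s : (0 < r)%R -> (0 < s)%R -> (l < kernel_avg N r s)%R =
    [&& (l < N)%R, (l * r < primitive s)%R & (l * s < primitive s)%R].
  move=> r0 s0; rewrite /kernel_avg lt_min minr_pMl ?primitive_ge0// lt_min.
  by rewrite ![(_^-1 * _)%R]mulrC !ltr_pdivlMr// andbC.
split.
  rewrite /trunc_sup; case: ifPn => [rN|_]; last by rewrite ltNge l0.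
  move=> /(sup_gt (trunc_sup_has_sup _ _ rN).1)[_ [s + <-]].
  rewrite /= in_itv/= => sN; rewrite key; [|by case/andP : rN|by case/andP : sN].
  by move=> /and3P[? ? ?]; split=> //; exists s.
move=> [rN lN [s sN [H1 H2]]]; apply: lt_le_trans (kernel_avg_le _ _ _ rN sN).
by rewrite key ?lN ?H1//; [case/andP : rN|case/andP : sN].
Qed.

(** The witness [s] of the right endpoint also serves every smaller positive point. *)
Lemma is_interval_lt_trunc_sup N l : (0 <= l)%R ->
  is_interval [set r | l < trunc_sup N r]%R.
Proof.
move=> l0 x z /= /(lt_trunc_supP _ _ _ l0)[/andP[x0 _] _ _].
move=> /(lt_trunc_supP _ _ _ l0)[/andP[z0 zN] lN [s sN [Hz Hs]]] y /andP[xy yz].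
apply/(lt_trunc_supP _ _ _ l0); split => //.
  by rewrite (lt_le_trans x0)//= (le_lt_trans yz).
by exists s => //; split => //; apply: le_lt_trans Hz; rewrite ler_wpM2l.
Qed.

(** Although the supremum is uncountable, its superlevel sets are intervals for [l >= 0] and the
    whole line for [l < 0]. *)
Lemma measurable_trunc_sup N : measurable_fun setT (trunc_sup N).
Proof.
apply: (measurability (@RGenOInfty.G R)) => [|/= _ [_] [l] -> <-].
  exact: RGenOInfty.measurableE.
rewrite setTI preimage_itvoy; have [l0|l0] := leP 0%R l.
  by apply: is_interval_measurable; exact: is_interval_lt_trunc_sup.
rewrite (_ : [set _ | _] = setT)//; apply/seteqP; split => // r _ /=.
exact: lt_le_trans l0 (trunc_sup_ge0 _ _).
Qed.

Lemma trunc_sup_weak_type N l : (0 < l)%R ->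
  l%:E * mu [set r | l < trunc_sup N r]%R <=
  \int[mu]_(r in [set r | l < trunc_sup N r]%R) (f r)%:E.
Proof.
move=> l0; set E := [set r | _].
have mE : measurable E.
  by apply: is_interval_measurable; apply: is_interval_lt_trunc_sup; exact: ltW.
have : 0 <= \int[mu]_(r in E) (f r)%:E by apply: integral_ge0 => x _; rewrite lee_fin.
have EP r : E r -> (0 < r)%R /\ (l * r)%:E <= \int[mu]_(r in E) (f r)%:E.
  move=> /(lt_trunc_supP _ _ _ (ltW l0))[/andP[r0 rN] lN [s sN [Hr Hs]]]; split => //.
  apply: (@le_trans _ _ (primitive s)%:E); first by rewrite lee_fin ltW.
  rewrite primitiveE; apply: ge0_subset_integral => //.
  - by apply/measurable_EFinP; exact: measurable_funTS.
  - by move=> x _; rewrite lee_fin.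
  (* Every [x] in []0, s[] lies in [E] with the same witness [s]; restricting [s] to []0, N]]
     guarantees that [x] also passes the cut-off. *)
  move=> x /=; rewrite in_itv/= => /andP[x0 xs].
  apply/(lt_trunc_supP _ _ _ (ltW l0)); split => //.
    by rewrite x0 (lt_le_trans xs)//; case/andP : sN.
  by exists s => //; split => //; apply: lt_trans Hs; rewrite ltr_pM2l.
case: (\int[mu]_(r in E) _) EP => [c| |] // EP; last by move=> _; rewrite leey.
rewrite lee_fin => c0.
(* The bound [l r <= c] at every point of [E] confines [E] to an interval of length [c / l]. *)
have EI : E `<=` `]0%R, (c / l)%R].
  move=> r /EP[r0]; rewrite lee_fin => Hr.
  by rewrite /= in_itv/= r0 ler_pdivlMr// mulrC.
apply: (@le_trans _ _ (l%:E * mu `]0%R, (c / l)%R])).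
  by rewrite lee_pmul2l ?lte_fin//; apply: le_measure; rewrite ?inE.
rewrite lebesgue_measure_itv/= lte_fin; case: ifPn => _.
  by rewrite sube0 -EFinM mulrC divfK// gt_eqF.
by rewrite mule0 lee_fin.
Qed.

Lemma trunc_sup_strong_type N : (0 < N)%R ->
  \int[mu]_r (trunc_sup N r `^ p)%:E <=
    ((p / (p - 1)) `^ p)%:E * \int[mu]_r (f r `^ p)%:E.
Proof.
move=> N0; apply: weak_type_strong_type => //.
- exact: measurable_trunc_sup.
- exact: trunc_sup_ge0.
- exact: trunc_sup_weak_type.
have p0 : (0 < p)%R by exact: lt_trans p1.
(* A priori finiteness: the truncated function is at most [N] and vanishes off []0, N[]. *)
apply: (@le_lt_trans _ _ (\int[mu]_(r in `]0%R, N[) (N `^ p)%:E)).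
  rewrite [leRHS]integral_mkcond; apply: ge0_le_integral_nonmeasurable => r _.
    by rewrite lee_fin powR_ge0.
  rewrite patchE; case: ifPn => [_|].
    rewrite lee_fin ge0_ler_powR// ?(ltW p0)// ?nnegrE ?trunc_sup_ge0//; first exact: ltW.
    exact/trunc_sup_le/ltW.
  rewrite notin_setE/= in_itv/= => /negP rN.
  by rewrite /trunc_sup (negbTE rN) powR0// gt_eqF.
rewrite integral_cst// [X in _ * X]lebesgue_measure_itv/= lte_fin N0 sube0.
by rewrite -EFinM ltry.
Qed.

(** Raising the parameter relaxes the cut-off in [r], the range of [s] and the cap together. *)
Lemma trunc_sup_nd r : nondecreasing_seq (fun n : nat => trunc_sup n%:R r).
Proof.
move=> n m nm; have nm' : (n%:R <= m%:R :> R)%R by rewrite ler_nat.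
rewrite {1}/trunc_sup; case: ifPn => [rn|_]; last exact: trunc_sup_ge0.
apply: ge_sup; first exact: (trunc_sup_has_sup _ _ rn).1.
move=> _ [s + <-]; rewrite /= in_itv/= => /andP[s0 sn].
apply: (@le_trans _ _ (kernel_avg m%:R r s)).
  by rewrite /kernel_avg le_min !ge_min lexx/= nm' orbT.
apply: kernel_avg_le; first by case/andP : rn => -> /lt_le_trans; apply.
by rewrite s0 (le_trans sn).
Qed.

Lemma le_trunc_sup r s : (0 < r)%R -> (0 < s)%R ->
  exists n : nat, (Num.min r^-1 s^-1 * primitive s <= trunc_sup n%:R r)%R.
Proof.
move=> r0 s0; set v := (_ * _)%R.
(* Once [n] exceeds [r], [s] and the value [v], neither the cut-offs nor the cap affect this [s]. *)
pose n := (Num.truncn (Num.max r (Num.max s v))).+1.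
have : (Num.max r (Num.max s v) < n%:R)%R by exact: truncnS_gt.
rewrite !gt_max => /and3P[rn sn vn].
exists n; apply: le_trans (kernel_avg_le _ _ s _ _); rewrite ?r0 ?s0 ?(ltW sn)//.
by rewrite /kernel_avg le_min lexx ltW.
Qed.

End truncated.

(** * Passage to the limit in the truncation *)

Theorem theorem2p1 (R : realType) (p : R) (f : R -> R)
  (hp : 1 < p)
  (fmeas : measurable_fun (`]0%R, +oo[ : set R) f)
  (fLp : (\int[(@lebesgue_measure R)]_(x in `]0%R, +oo[) (`|f x| `^ p)%:E < +oo)%E) :
  (\int[(@lebesgue_measure R)]_(r in `]0%R, +oo[)
      ereal_sup [set (`| ((Num.min r^-1 s^-1)%:E
                          * \int[(@lebesgue_measure R)]_(t in `]0%R, s[) (f t)%:E) | `^ p)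
                | s in `]0%R, +oo[]
   <= ((p / (p - 1)) `^ p)%:E
      * \int[(@lebesgue_measure R)]_(r in `]0%R, +oo[) (`|f r| `^ p)%:E)%E.
Proof.
have p0 : 0 < p by exact: lt_trans hp.
(* Extending [|f|] by zero gives a nonnegative function on the whole line, as the truncated
   estimates require. *)
pose phi := (fun x => `|f x|) \_ (`]0%R, +oo[ : set R).
have mphi : measurable_fun setT phi.
  apply/(measurable_restrictT _ _).1 => //.
  exact: (measurableT_comp (@normr_measurable R setT) fmeas).
have phi0 x : 0 <= phi x by rewrite /phi patchE; case: ifP.
have phiE x : 0 < x -> phi x = `|f x|.
  by move=> x0; rewrite /phi patchE mem_set//= in_itv/= x0.
have eqp : (\int[(@lebesgue_measure R)]_(r in `]0%R, +oo[) (`|f r| `^ p)%:E =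
    \int[(@lebesgue_measure R)]_r (phi r `^ p)%:E)%E.
  rewrite [LHS]integral_mkcond; apply: eq_integral => x _; rewrite /phi !patchE.
  by case: ifP => // _; rewrite powR0// gt_eqF.
rewrite eqp in fLp *.
pose u (n : nat) (r : R) := (trunc_sup R phi n%:R r `^ p)%:E.
have mu_ n : measurable_fun setT (u n).
  apply/measurable_EFinP; apply: (measurableT_comp (measurable_powR p)).
  exact: measurable_trunc_sup.
have u0 n r : (0 <= u n r)%E by rewrite lee_fin powR_ge0.
have undec r : nondecreasing_seq (u^~ r).
  move=> n m nm; rewrite lee_fin; apply: ge0_ler_powR;
    rewrite ?nnegrE ?trunc_sup_ge0 ?(ltW p0)//.
  exact: trunc_sup_nd.
have ule n r : (u n r <= limn (u^~ r))%E.
  rewrite (cvg_lim _ (ereal_nondecreasing_cvgn (undec r)))//.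
  by apply: ereal_sup_ubound; exists n.
(* The integrand is dominated pointwise by a measurable increasing limit, to which monotone
   convergence applies. *)
apply: (@le_trans _ _ (\int[(@lebesgue_measure R)]_r limn (u^~ r))%E).
  rewrite [leLHS]integral_mkcond; apply: ge0_le_integral_nonmeasurable => r _.
    apply: erestrict_ge0 => x x0.
    apply: le_trans (ereal_sup_ubound _); last first.
      (* Any element of the family shows that the supremum is nonnegative; [s = 1] is an arbitrary
         choice. *)
      by exists 1 => //; rewrite /= in_itv/= ltr01.
    exact: poweR_ge0.
  rewrite patchE; case: ifPn => [|_]; last by apply: le_trans (ule 0%N r).
  rewrite inE/= in_itv/= andbT => r0.
  apply: ge_ereal_sup => _ [s + <-]; rewrite /= in_itv/= andbT => s0.
  have [n hn] := le_trunc_sup R phi r s r0 s0.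
  apply: le_trans (ule n r).
  have m0 : 0 <= Num.min r^-1 s^-1 by rewrite le_min !invr_ge0 !ltW.
  rewrite /u -poweR_EFin; apply: gt0_ler_poweR;
    rewrite ?in_itv/= ?abse_ge0 ?leey ?lee_fin ?trunc_sup_ge0 ?(ltW p0)//.
  apply: (@le_trans _ _ (Num.min r^-1 s^-1 * primitive R phi s)%:E); last by rewrite lee_fin.
  rewrite abseM gee0_abs ?lee_fin// EFinM lee_wpmul2l ?lee_fin//.
  rewrite (primitiveE R phi p)//.
  have sub : `]0, s[ `<=` (`]0, +oo[ : set R).
    by move=> t /=; rewrite !in_itv/= andbT => /andP[].
  apply: le_trans (le_abse_integral _ _ _) _ => //.
    by apply/measurable_EFinP; exact: measurable_funS fmeas.
  apply: ge0_le_integral_nonmeasurable => t; rewrite ?abse_ge0//= in_itv/= => /andP[t0 _].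
  by rewrite phiE// abse_EFin.
rewrite monotone_convergence//.
apply: lime_le.
  apply: ereal_nondecreasing_is_cvgn => n m nm; apply: ge0_le_integral => //.
  - exact: mu_.
  - exact: mu_.
  - by move=> r _; exact: undec.
(* The bound is uniform in [n], but it is available only for a positive truncation level, hence for
   large [n]. *)
near=> n; apply: trunc_sup_strong_type => //.
by rewrite ltr0n; near: n; exact: nbhs_infty_gt.
Unshelve. all: by end_near.
Qed.
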